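(* Let $M>0$, $\nu>0$, and let $\Xi$ be the function $$\Xi(c,Q)=c\log c+(M-c)\log\Big(1-\frac{c}{M}\Big)+c\,\nu\, q(Q/c)$$ with the conventions of the context. Then: 1. $\Xi$ is invariant under rotations: for any $2\times2$ real matrix $T$ with $TT^t=I$, $\Xi(c,TQT^t)=\Xi(c,Q)$. 2. $\Xi$ is strictly convex on $\mathcal{Q}_{\mathrm{phys}}^M$ and has a finite lower bound. 3. $\Xi$ is lower semicontinuous on $\overline{\mathcal{Q}_{\mathrm{phys}}^M}$.
   Context: $I$ is the $2\times2$ identity matrix. For a real symmetric traceless $2\times2$ matrix $S$ whose eigenvalues $\lambda(S)$ lie in $(-1/2,1/2)$, define $q(S)=-\log\det(S+I/2)+\log\det(I/2)$; if the eigenvalues are not in this range, $q(S)=+\infty$. The physical domain is $$\mathcal{Q}_{\mathrm{phys}}^M=\Big\{(c,Q): c\in\mathbb{R},\ c\le M,\ \text{and either } c=0,\ Q=0,\ \text{or } c>0,\ Q=Q^t,\ \mathrm{tr}\,Q=0,\ \lambda(Q)\in\big(-\tfrac c2,\tfrac c2\big)\Big\},$$ with $Q$ a real $2\times 2$ matrix and $\lambda(Q)$ denoting all its eigenvalues. Its closure is $$\overline{\mathcal{Q}_{\mathrm{phys}}^M}=\Big\{(c,Q): 0\le c\le M,\ Q=Q^t,\ \mathrm{tr}\,Q=0,\ \lambda(Q)\in\big[-\tfrac c2,\tfrac c2\big]\Big\}.$$ Conventions: $0\log 0=0$ (so $c\log c=0$ at $c=0$ and $(M-c)\log(1-c/M)=0$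 at $c=M$), $\Xi(0,0)=0$, and $\Xi(c,Q)=+\infty$ when $|\lambda(Q)|=c/2>0$. *)

(* Defs.v *)
From HB Require Import structures.
From mathcomp Require Import all_boot all_order all_algebra.
From mathcomp Require Import ring lra.
From mathcomp Require Import all_classical all_reals all_analysis.
Set Implicit Arguments.
Unset Strict Implicit.
Unset Printing Implicit Defensive.
Import Order.TTheory GRing.Theory Num.Theory.
Import numFieldNormedType.Exports.
Local Open Scope classical_set_scope.
Local Open Scope ring_scope.

Definition spectrum_in (R : realType) (S : 'M[R]_2) (I : interval R) : Prop :=
  forall l : R, eigenvalue S l -> l \in I.

Definition sym_traceless (R : realType) (S : 'M[R]_2) : Prop :=
  S^T = S /\ \tr S = 0.

(* Quantifying over eigenvalues in [R] suffices: a symmetric matrix has no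
   others. *)
Definition q (R : realType) (S : 'M[R]_2) : \bar R :=
  if `[< spectrum_in S `](- 2^-1), 2^-1[ >]
  then (- ln (\det (S + (2^-1)%:M)) + ln (\det ((2^-1)%:M : 'M[R]_2)))%:E
  else +oo%E.

(* The convention 0 log 0 = 0 is automatic, [ln] being total. [Xi] is +oo if
   |lambda(Q)| = c/2 > 0, because [q (c^-1 *: Q)] is and [c * nu > 0]. *)
Definition Xi (R : realType) (M nu : R) (x : R^o * 'M[R]_2) : \bar R :=
  let: (c, Q) := x in
  if (c == 0) && (Q == 0) then 0%E
  else ((c * ln c + (M - c) * ln (1 - c / M))%:E
        + (c * nu)%:E * q (c^-1 *: Q))%E.

Definition Qphys (R : realType) (M : R) : set (R^o * 'M[R]_2) :=
  [set x | let: (c, Q) := x in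
    c <= M /\
    ((c = 0 /\ Q = 0) \/
     [/\ 0 < c, sym_traceless Q & spectrum_in Q `](- (c / 2)), (c / 2)[])].

Definition Qphysbar (R : realType) (M : R) : set (R^o * 'M[R]_2) :=
  [set x | let: (c, Q) := x in
    [/\ 0 <= c <= M, sym_traceless Q & spectrum_in Q `[- (c / 2), c / 2]]].

Fact lift01 : lift ord0 ord0 = 1 :> 'I_2.
Proof. exact: val_inj. Qed.

Fact lift10 : lift (1 : 'I_2) ord0 = 0 :> 'I_2.
Proof. exact: val_inj. Qed.

Fact ord2P (i : 'I_2) : i = 0 \/ i = 1.
Proof. by case: i => [[|[|//]] hi]; [left|right]; apply: val_inj. Qed.

Lemma mxtrace2 (R : comPzRingType) (A : 'M[R]_2) : \tr A = A 0 0 + A 1 1.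
Proof. by rewrite /mxtrace !big_ord_recl big_ord0 addr0 lift01. Qed.

Lemma det2 (R : comPzRingType) (A : 'M[R]_2) :
  \det A = A 0 0 * A 1 1 - A 0 1 * A 1 0.
Proof.
rewrite (expand_det_row _ ord0) !big_ord_recl big_ord0 /cofactor !det_mx11 !mxE.
by rewrite lift01 lift10 /= addr0 expr0 expr1 mul1r mulN1r mulrN.
Qed.

Lemma eigenvalue_sym_traceless (R : realType) (Q : 'M[R]_2) (l : R) :
  sym_traceless Q -> eigenvalue Q l = (l ^+ 2 == Q 0 0 ^+ 2 + Q 0 1 ^+ 2).
Proof.
move=> [Qs Qt].
have Q10 : Q 1 0 = Q 0 1 by rewrite -{1}Qs mxE.
have Q11 : Q 1 1 = - Q 0 0.
  by apply/eqP; rewrite -addr_eq0 addrC -mxtrace2 Qt.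
have detE : \det (l%:M - Q) = l ^+ 2 - (Q 0 0 ^+ 2 + Q 0 1 ^+ 2).
  by rewrite det2 !mxE Q10 Q11 /= mulr0n mulr1n; ring.
rewrite -[RHS]subr_eq0 -detE.
apply/idP/idP.
  move=> /eigenvalueP[v vQ v0]; apply/det0P; exists v => //.
  by rewrite mulmxBr vQ mul_mx_scalar subrr.
move=> /det0P[v v0 vQ]; apply/eigenvalueP; exists v => //.
by apply/esym/eqP; rewrite -subr_eq0 -mul_mx_scalar -mulmxBr vQ.
Qed.

Lemma spectrum_in_oo (R : realType) (Q : 'M[R]_2) (r : R) :
  sym_traceless Q -> 0 < r ->
  (spectrum_in Q `](- r), r[) <-> Q 0 0 ^+ 2 + Q 0 1 ^+ 2 < r ^+ 2.
Proof.
move=> Qst r0; split=> [|N l]; last first.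
  rewrite eigenvalue_sym_traceless// => /eqP lE.
  by rewrite in_itv/= -ltr_norml -ltr_sqr ?nnegrE ?normr_ge0 ?ltW// real_normK ?num_real// lE.
set N := _ + _ => /(_ (Num.sqrt N)).
have N0 : 0 <= N by rewrite addr_ge0 ?sqr_ge0.
rewrite eigenvalue_sym_traceless// sqr_sqrtr// eqxx => /(_ isT).
rewrite in_itv/= => /andP[_ h].
by rewrite -(sqr_sqrtr N0) ltr_sqr ?nnegrE ?sqrtr_ge0 ?ltW.
Qed.

Lemma spectrum_in_cc (R : realType) (Q : 'M[R]_2) (r : R) :
  sym_traceless Q -> 0 <= r ->
  (spectrum_in Q `[(- r), r]) <-> Q 0 0 ^+ 2 + Q 0 1 ^+ 2 <= r ^+ 2.
Proof.
move=> Qst r0; split=> [|N l]; last first.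
  rewrite eigenvalue_sym_traceless// => /eqP lE.
  by rewrite in_itv/= -ler_norml -ler_sqr ?nnegrE ?normr_ge0// real_normK ?num_real// lE.
set N := _ + _ => /(_ (Num.sqrt N)).
have N0 : 0 <= N by rewrite addr_ge0 ?sqr_ge0.
rewrite eigenvalue_sym_traceless// sqr_sqrtr// eqxx => /(_ isT).
rewrite in_itv/= => /andP[_ h].
by rewrite -(sqr_sqrtr N0) ler_sqr ?nnegrE ?sqrtr_ge0.
Qed.

Lemma sym_traceless_eq0 (R : realType) (Q : 'M[R]_2) :
  sym_traceless Q -> Q 0 0 ^+ 2 + Q 0 1 ^+ 2 <= 0 -> Q = 0.
Proof.
move=> [Qs Qt] N0.
have /andP[/eqP Q00 /eqP Q01] : (Q 0 0 == 0) && (Q 0 1 == 0).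
  rewrite -(sqrf_eq0 (Q 0 0)) -(sqrf_eq0 (Q 0 1)) -paddr_eq0 ?sqr_ge0//.
  by rewrite eq_le N0 addr_ge0 ?sqr_ge0.
have Q10 : Q 1 0 = 0 by rewrite -Qs mxE.
have Q11 : Q 1 1 = 0.
  by move: Qt; rewrite mxtrace2 Q00 add0r.
by apply/matrixP => i j; rewrite mxE; case: (ord2P i) => ->; case: (ord2P j) => ->.
Qed.

Lemma closure_Qphys (R : realType) (M : R) :
  closure (Qphys M) = Qphysbar M.
Proof.
have sub : Qphys M `<=` Qphysbar M.
  move=> [c Q] [cM [[c0 Q0]|[c0 Qst sp]]].
    rewrite c0 in cM *; rewrite Q0.
    have st0 : @sym_traceless R 0 by split; rewrite ?trmx0 ?mxtrace0.
    split=> //; first by rewrite lexx cM.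
    rewrite mul0r; apply/spectrum_in_cc => //.
    by rewrite !mxE expr0n /= addr0.
  split=> //; first by rewrite (ltW c0) cM.
  apply/spectrum_in_cc; rewrite ?divr_ge0 ?ltW//.
  by apply/spectrum_in_oo; rewrite ?divr_gt0.
have cl : closed (Qphysbar M).
  have cfst : continuous (fun x : R^o * 'M[R]_2 => x.1 : R).
    by move=> x; exact: cvg_fst.
  have cent i j : continuous (fun x : R^o * 'M[R]_2 => x.2 i j : R).
    move=> x; apply: (@continuous_comp _ _ _ snd (fun A : 'M[R]_2 => A i j)).
      exact: cvg_snd.
    exact: coord_continuous.
  pose skew (x : R^o * 'M[R]_2) : R := x.2 1 0 - x.2 0 1.
  pose trace (x : R^o * 'M[R]_2) : R := x.2 0 0 + x.2 1 1.
  pose gap (x : R^o * 'M[R]_2) : R :=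
    x.2 0 0 * x.2 0 0 + x.2 0 1 * x.2 0 1 - (x.1 / 2) * (x.1 / 2).
  have -> : Qphysbar M =
      fst @^-1` [set y : R | 0 <= y] `&` fst @^-1` [set y : R | y <= M]
      `&` skew @^-1` [set y | y = 0] `&` trace @^-1` [set y | y = 0]
      `&` gap @^-1` [set y | y <= 0].
    apply/seteqP; split=> -[c Q]; rewrite /skew /trace /gap /=.
      move=> [/andP[c0 cM] Qst sp].
      have [Qs Qt] := Qst.
      move: sp => /spectrum_in_cc; rewrite divr_ge0// !expr2 => /(_ Qst isT) h.
      rewrite subr_le0; split=> //; split; [split; [by split|]|].
        by rewrite -{1}Qs mxE subrr.
      by rewrite -mxtrace2.
    move=> [[[[c0 cM] Q10] Qt] N].
    have Qst : sym_traceless Q.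
      split.
        have e : Q 1 0 = Q 0 1 by apply/eqP; rewrite -subr_eq0 Q10.
        by apply/matrixP => i j; rewrite mxE; case: (ord2P i) => ->; case: (ord2P j) => ->.
      by rewrite mxtrace2.
    split=> //; first by rewrite c0.
    by apply/spectrum_in_cc; rewrite ?divr_ge0// !expr2 -subr_le0.
  apply: closedI; [apply: closedI; [apply: closedI; [apply: closedI|]|]|].
  - by apply: preimage_closed (@closed_ge R 0) => x _; exact: cfst.
  - by apply: preimage_closed (@closed_le R M) => x _; exact: cfst.
  - apply: preimage_closed (@closed_eq R 0) => x _.
    by apply: cvgB; exact: cent.
  - apply: preimage_closed (@closed_eq R 0) => x _.
    by apply: cvgD; exact: cent.
  - apply: preimage_closed (@closed_le R 0) => x _.
    apply: cvgB; first by apply: cvgD; apply: cvgM; exact: cent.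
    by apply: cvgM; (apply: cvgM; [exact: cfst|exact: cvg_cst]).
apply/seteqP; split.
  by rewrite [X in _ `<=` X](closure_id _).1//; exact: closureS.
move=> [c Q] [/andP[c0 cM] Qst sp].
have [c00|cn0] := eqVneq c 0.
  apply: subset_closure; split=> //; left; split=> //.
  apply: sym_traceless_eq0 => //.
  have := (@spectrum_in_cc R Q (c / 2) Qst); rewrite divr_ge0// => /(_ isT) [h _].
  by have := h sp; rewrite c00 mul0r expr0n.
have cp : 0 < c by rewrite lt_neqAle eq_sym cn0.
have NQ : Q 0 0 ^+ 2 + Q 0 1 ^+ 2 <= (c / 2) ^+ 2.
  by apply/spectrum_in_cc; rewrite ?divr_ge0.
have cvgQ : (((c : R^o), (1 - e) *: Q) : R^o * 'M[R]_2) @[e --> (0:R)^'+] -->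
    (((c : R^o), Q) : R^o * 'M[R]_2).
  apply: (@cvg_pair R R^o 'M[R]_2 (0:R)^'+ (nbhs (c : R^o)) (nbhs Q)).
    exact: cvg_cst.
  have : (1 - e) *: Q @[e --> (0:R)^'+] --> (1 - 0) *: Q; last first.
    by rewrite subr0 scale1r.
  apply: cvgZr_tmp; apply: cvgB; first exact: cvg_cst.
  exact: cvg_at_right_filter.
move=> B /cvgQ Bnear.
have : \forall e \near (0:R)^'+, 0 < e < 1 /\ B ((c : R^o), (1 - e) *: Q).
  near=> e; split; last by near: e.
  by apply/andP; split; near: e; [exact: nbhs_right_gt|exact: nbhs_right_lt].
move=> /filter_ex[e [/andP[e0 e1] Be]].
exists ((c : R^o), (1 - e) *: Q); split=> //.
have Qst' : sym_traceless ((1 - e) *: Q).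
  by case: Qst => Qs Qt; split; rewrite ?linearZ /= ?Qs ?Qt ?mulr0.
split=> //; right; split=> //.
apply/spectrum_in_oo; rewrite ?divr_gt0// !mxE.
rewrite [X in X + _]exprMn [X in _ + X]exprMn -mulrDr.
apply: (@le_lt_trans _ _ ((1 - e) ^+ 2 * (c / 2) ^+ 2)).
  by rewrite ler_wpM2l ?sqr_ge0.
rewrite gtr_pMl ?exprn_gt0 ?divr_gt0//.
by rewrite expr_lt1//; lra.
Unshelve. all: by end_near. Qed.

Lemma Xi_boundary (R : realType) (M nu c l : R) (Q : 'M[R]_2) :
  0 < nu -> 0 < c -> eigenvalue Q l -> `|l| = c / 2 -> Xi M nu (c, Q) = +oo%E.
Proof.
move=> nu0 c0 /eigenvalueP[v vQ v0] lc; rewrite /Xi gt_eqF//=.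
rewrite /q; case: asboolP => [sp|_]; last first.
  by rewrite gt0_muley ?lte_fin ?mulr_gt0// addey.
have : eigenvalue (c^-1 *: Q) (c^-1 * l).
  by apply/eigenvalueP; exists v => //; rewrite -scalemxAr vQ scalerA.
move=> /sp; rewrite in_itv/= -ltr_norml normrM lc.
by rewrite gtr0_norm ?invr_gt0// mulKf ?gt_eqF// ltxx.
Qed.

Definition strictly_convex_on (R : realType) (E : lmodType R) (D : set E)
    (f : E -> \bar R) : Prop :=
  @convex_set R E D /\
  forall (x y : E) (t : R), D x -> D y -> x <> y -> 0 < t < 1 ->
    (f (t *: x + (1 - t) *: y)%R < t%:E * f x + (1 - t)%:E * f y)%E.

Definition lsc_on (R : realType) (X : topologicalType) (D : set X)
    (f : X -> \bar R) : Prop :=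
  @lower_semicontinuous (subspace D) R f.

(* Main.v *)
Require Import Defs.
From HB Require Import structures.
From mathcomp Require Import all_boot all_order all_algebra.
From mathcomp Require Import ring lra.
From mathcomp Require Import all_classical all_reals all_analysis.
Import Order.TTheory GRing.Theory Num.Theory.
Import numFieldNormedType.Exports.
Local Open Scope classical_set_scope.
Local Open Scope ring_scope.

(** A symmetric traceless [Q] with first row [(a, b)] has eigenvalues plus and minus the norm of
    [(a, b)]. In these coordinates [Xi] becomes [energy c a b]: [c ln c], plus [M] times [xlnx] at
    [1 - c / M], plus [nu] times the perspective [c f(a / c, b / c)] of
    [f = - ln (1 - 4 (a^2 + b^2))]. Each summand is a supremum of affine functions: tangent lines
    for [u ln u], and the functions [tilt], linear in [(c, a, b)], for the perspective.

    Convexity follows by taking tangents that are exact at the intermediate point and comparing them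
    with the functions at the endpoints. A perspective is linear along rays, so strictness has two
    sources: [c ln c] if the two values of [c] differ, and [perspective_strict_convex] if they
    agree.

    The sums [energy_minorant] are continuous, lie below [Xi] on the closure
    ([energy_minorant_le_Xi]) and exceed every real below [Xi], even where [Xi] is [+oo]
    ([energy_minorant_approx]). This gives lower semicontinuity, and one minorant is the constant
    [- 1]. Rotation invariance holds because orthogonal conjugation preserves eigenvalues and
    determinants. *)

Section TangentBounds.
Context {R : realType}.
Implicit Types (u v w c a b p r t : R).

(** * Tangent lines of the logarithm and of [u ln u] *)

Lemma ln_lt_subr1 {u} : 0 < u -> u != 1 -> ln u < u - 1.
Proof.
move=> u0 u1; have lnu : ln u != 0 by rewrite ln_eq0.
by have := expR_gt1Dx lnu; rewrite lnK ?posrE//; lra.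
Qed.

Lemma ln_le_subr1 {u} : 0 < u -> ln u <= u - 1.
Proof.
move=> u0; have [->|u1] := eqVneq u 1; first by rewrite ln1 subrr.
exact/ltW/ln_lt_subr1.
Qed.

Lemma ln_tangent {u w} : 0 < u -> 0 < w -> 1 - ln w - u / w <= - ln u.
Proof.
move=> u0 w0; have := ln_le_subr1 (divr_gt0 u0 w0).
by rewrite ln_div ?posrE//; lra.
Qed.

Definition xlnx u := u * ln u.

(** Multiplying [ln (w / u) < w / u - 1] by [u] gives the tangent at [w]; at [u = 0] this line takes
    the value [- w < 0]. *)
Lemma xlnx_tangent_lt {u w} : 0 <= u -> 0 < w -> u != w ->
  u * (1 + ln w) - w < xlnx u.
Proof.
rewrite /xlnx le_eqVlt => /predU1P[<- w0 _|u0 w0 uw].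
  by rewrite !mul0r; lra.
have wu1 : w / u != 1.
  by apply: contra_neq uw => /divr1_eq.
have := ln_lt_subr1 (divr_gt0 w0 u0) wu1.
rewrite ln_div ?posrE// -(ltr_pM2l u0).
by rewrite [ltRHS]mulrBr [u * (w / u)]mulrC divfK ?gt_eqF//; lra.
Qed.

Lemma xlnx_tangent {u w} : 0 <= u -> 0 < w -> u * (1 + ln w) - w <= xlnx u.
Proof.
move=> u0 w0; have [->|uw] := eqVneq u w; first by rewrite /xlnx; lra.
exact/ltW/xlnx_tangent_lt.
Qed.

(** For [u > 0] the tangent at [u] is exact. At [u = 0] the slope is infinite and no tangent is
    exact, but the tangent at a small [w] takes the value [- w] there. *)
Lemma xlnx_tangent_approx {u a} : 0 <= u -> a < xlnx u ->
  exists2 w, 0 < w & a < u * (1 + ln w) - w.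
Proof.
rewrite /xlnx le_eqVlt => /predU1P[<-|u0 au]; last by exists u => //; lra.
by rewrite mul0r => a0; exists (- a / 2); lra.
Qed.

Lemma xlnx_strict_convex {u v t} : 0 <= u -> 0 <= v -> 0 < t < 1 -> u != v ->
  xlnx (t * u + (1 - t) * v) < t * xlnx u + (1 - t) * xlnx v.
Proof.
move=> u0 v0 /andP[t0 t1] uv; set m := _ + _.
have t1' : 0 < 1 - t by lra.
have um : u != m.
  rewrite -subr_eq0 (_ : u - m = (1 - t) * (u - v)) /m; last by ring.
  by rewrite mulf_neq0 ?subr_eq0// gt_eqF.
have m0 : 0 < m.
  have m_ge0 : 0 <= m by rewrite addr_ge0// mulr_ge0// ltW.
  rewrite lt_neqAle m_ge0 andbT eq_sym /m.
  apply: contra_neq uv => /eqP; rewrite paddr_eq0 ?mulr_ge0 ?(ltW t0) ?(ltW t1')//.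
  by rewrite !mulf_eq0 (gt_eqF t0) (gt_eqF t1') /= => /andP[/eqP-> /eqP->].
(* The tangent at [m] is affine, so its values at [u] and [v] average to [xlnx m]; strictness at [u]
   suffices. *)
have lu := xlnx_tangent_lt u0 m0 um; have lv := xlnx_tangent v0 m0.
rewrite -(ltr_pM2l t0) in lu; rewrite -(ler_pM2l t1') in lv.
have -> : xlnx m = t * (u * (1 + ln m) - m) + (1 - t) * (v * (1 + ln m) - m).
  by rewrite /xlnx; move: (ln m) => l; rewrite /m; ring.
lra.
Qed.

Lemma xlnx_convex {u v t} : 0 <= u -> 0 <= v -> 0 < t < 1 ->
  xlnx (t * u + (1 - t) * v) <= t * xlnx u + (1 - t) * xlnx v.
Proof.
move=> u0 v0 t01; have [->|uv] := eqVneq u v; last exact/ltW/xlnx_strict_convex.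
by rewrite -!mulrDl addrC subrK !mul1r.
Qed.

                                                                         
                        
(** * The perspective of [- ln (1 - 4 (a^2 + b^2))] and its linear minorants *)

Definition perspective c a b := c * - ln (1 - 4 * (a ^+ 2 + b ^+ 2) / c ^+ 2).

Definition phys_cone c a b :=
  (c = 0 /\ (a = 0 /\ b = 0)) \/ (0 < c /\ 4 * (a ^+ 2 + b ^+ 2) < c ^+ 2).

                                                                             
                                              
(** The tangent of [- ln] at [w], evaluated at [1 - 4 s] with [s] the tangent plane at [(p, r)] of
    the squared norm, and made homogeneous of degree one in [(c, a, b)]. *)
Definition tilt w p r c a b :=
  c * (1 - ln w) - (c - 4 * (2 * (p * a + r * b) - (p ^+ 2 + r ^+ 2) * c)) / w.

Lemma gap_gt0 {c a b} : 0 < c -> 4 * (a ^+ 2 + b ^+ 2) < c ^+ 2 ->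
  0 < 1 - 4 * (a ^+ 2 + b ^+ 2) / c ^+ 2.
Proof. by move=> c0 h; rewrite subr_gt0 ltr_pdivrMr ?exprn_gt0// mul1r. Qed.

(** The difference is the square [4 / (c w) |(a, b) - c (p, r)|^2], which also settles the equality
    case. *)
Lemma tilt_le_tangent {w} p r {c} a b : 0 < c -> 0 < w ->
  tilt w p r c a b <= c * (1 - ln w - (1 - 4 * (a ^+ 2 + b ^+ 2) / c ^+ 2) / w)
    ?= iff ((a == c * p) && (b == c * r)).
Proof.
move=> c0 w0; have cn0 := lt0r_neq0 c0; have wn0 := lt0r_neq0 w0.
have E : c * (1 - ln w - (1 - 4 * (a ^+ 2 + b ^+ 2) / c ^+ 2) / w)
    - tilt w p r c a b = 4 / (c * w) * ((a - c * p) ^+ 2 + (b - c * r) ^+ 2).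
  by rewrite /tilt; field; rewrite wn0 cn0.
split.
  by rewrite -subr_ge0 E mulr_ge0 ?divr_ge0 ?mulr_ge0 ?addr_ge0 ?sqr_ge0 ?ltW.
rewrite eq_sym -subr_eq0 E mulf_eq0 [4 / _ == 0]gt_eqF ?divr_gt0 ?mulr_gt0//=.
by rewrite paddr_eq0 ?sqr_ge0// !sqrf_eq0 !subr_eq0.
Qed.

Lemma tilt_le_perspective {w p r c a b} : 0 < w -> phys_cone c a b ->
  tilt w p r c a b <= perspective c a b.
Proof.
move=> w0 [[-> [-> ->]]|[c0 h]].
  by rewrite /tilt /perspective !(mul0r, mulr0, addr0, subr0).
rewrite (le_trans (tilt_le_tangent _ _ _ _ c0 w0).1)// ler_pM2l//.
by apply: ln_tangent => //; exact: gap_gt0.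
Qed.

Lemma tilt_lt_perspective {w p r c a b} : 0 < w -> phys_cone c a b ->
  0 < c -> ~ (a = c * p /\ b = c * r) -> tilt w p r c a b < perspective c a b.
Proof.
move=> w0 + c0 n; case=> [[c00 _]|[_ h]]; first by rewrite c00 ltxx in c0.
rewrite (@lt_le_trans _ _
  (c * (1 - ln w - (1 - 4 * (a ^+ 2 + b ^+ 2) / c ^+ 2) / w)))//.
  rewrite (lt_leif (tilt_le_tangent _ _ _ _ c0 w0)).
  by apply/negP => /andP[/eqP ? /eqP ?]; apply: n.
by rewrite ler_pM2l//; by apply: ln_tangent => //; exact: gap_gt0.
Qed.

Lemma tilt_eq_perspective {c a b} : phys_cone c a b -> 0 < c ->
  tilt (1 - 4 * (a ^+ 2 + b ^+ 2) / c ^+ 2) (a / c) (b / c) c a b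
  = perspective c a b.
Proof.
move=> + c0; case=> [[c00 _]|[_ h]]; first by rewrite c00 ltxx in c0.
have cn0 := lt0r_neq0 c0; have w0 := gap_gt0 c0 h.
have /eqP -> : tilt (1 - 4 * (a ^+ 2 + b ^+ 2) / c ^+ 2) (a / c) (b / c) c a b
    == c * (1 - ln (1 - 4 * (a ^+ 2 + b ^+ 2) / c ^+ 2)
      - (1 - 4 * (a ^+ 2 + b ^+ 2) / c ^+ 2) / (1 - 4 * (a ^+ 2 + b ^+ 2) / c ^+ 2)).
  by rewrite (tilt_le_tangent _ _ _ _ c0 w0).2 ![c * (_ / c)]mulrC !divfK ?eqxx.
by rewrite divff ?gt_eqF// /perspective; ring.
Qed.

(** By Cauchy-Schwarz the form [c^2 - 4 (a^2 + b^2)] has nonnegative cross terms on the cone, so its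
    value at a combination is at least the weighted sum of the values at the endpoints, with weights
    [t^2] and [(1 - t)^2]. *)
Lemma phys_cone_convex {t c a b c' a' b'} : 0 < t < 1 ->
  phys_cone c a b -> phys_cone c' a' b' ->
  phys_cone (t * c + (1 - t) * c') (t * a + (1 - t) * a') (t * b + (1 - t) * b').
Proof.
move=> /andP[t0 t1].
have weak x y z : phys_cone x y z -> 0 <= x /\ 4 * (y ^+ 2 + z ^+ 2) <= x ^+ 2.
  by case=> [[-> [-> ->]]|[/ltW ? /ltW]//]; rewrite expr0n /= addr0 mulr0.
move=> h h'; have [c0 N] := weak _ _ _ h; have [c'0 N'] := weak _ _ _ h'.
have t1' : 0 < 1 - t by lra.
have dot : 4 * (a * a' + b * b') <= c * c'.
  rewrite leNgt; apply/negP => lt.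
  have : (c * c') ^+ 2 < (4 * (a * a' + b * b')) ^+ 2.
    have cc0 := mulr_ge0 c0 c'0.
    by rewrite ltr_sqr ?nnegrE// (le_trans cc0)// ltW.
  apply/negP; rewrite -leNgt exprMn.
  have NN' : 4 * (a ^+ 2 + b ^+ 2) * (4 * (a' ^+ 2 + b' ^+ 2)) <= c ^+ 2 * c' ^+ 2.
    by rewrite ler_pM// mulr_ge0// addr_ge0 ?sqr_ge0.
  (* The defect in Lagrange's identity for [(a, b)] and [(a', b')]. *)
  have := sqr_ge0 (a * b' - b * a').
  by move: NN'; nra.
have E : (t * c + (1 - t) * c') ^+ 2
    - 4 * ((t * a + (1 - t) * a') ^+ 2 + (t * b + (1 - t) * b') ^+ 2)
  = t ^+ 2 * (c ^+ 2 - 4 * (a ^+ 2 + b ^+ 2))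
    + (1 - t) ^+ 2 * (c' ^+ 2 - 4 * (a' ^+ 2 + b' ^+ 2))
    + 2 * t * (1 - t) * (c * c' - 4 * (a * a' + b * b')) by ring.
have tt : 0 < t ^+ 2 by rewrite exprn_gt0.
have ss : 0 < (1 - t) ^+ 2 by rewrite exprn_gt0.
have X : 0 <= 2 * t * (1 - t) * (c * c' - 4 * (a * a' + b * b')).
  by rewrite !mulr_ge0 ?subr_ge0// ltW.
have Y : 0 <= t ^+ 2 * (c ^+ 2 - 4 * (a ^+ 2 + b ^+ 2)).
  by rewrite mulr_ge0 ?subr_ge0// ltW.
have Z : 0 <= (1 - t) ^+ 2 * (c' ^+ 2 - 4 * (a' ^+ 2 + b' ^+ 2)).
  by rewrite mulr_ge0 ?subr_ge0// ltW.
case: h => [[-> [-> ->]]|[c_gt0 lt]]; last first.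
  right; split; first by rewrite ltr_wpDr ?(mulr_gt0 t0)// mulr_ge0// ltW.
  rewrite -subr_gt0 E -addrA ltr_wpDr ?addr_ge0//.
  by rewrite mulr_gt0 ?subr_gt0.
case: h' => [[-> [-> ->]]|[c_gt0 lt]].
  by left; rewrite !mulr0 addr0.
right; rewrite !mulr0 !add0r mulr_gt0//; split=> //.
by rewrite !exprMn -mulrDr mulrCA ltr_pM2l.
Qed.

Lemma tilt_affine w p r t c a b c' a' b' :
  tilt w p r (t * c + (1 - t) * c') (t * a + (1 - t) * a') (t * b + (1 - t) * b')
  = t * tilt w p r c a b + (1 - t) * tilt w p r c' a' b'.
Proof. by rewrite /tilt; ring. Qed.

Lemma perspective_convex {t c a b c' a' b'} : 0 < t < 1 ->
  phys_cone c a b -> phys_cone c' a' b' ->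
  perspective (t * c + (1 - t) * c') (t * a + (1 - t) * a') (t * b + (1 - t) * b')
  <= t * perspective c a b + (1 - t) * perspective c' a' b'.
Proof.
move=> t01 h h'; have hm := phys_cone_convex t01 h h'.
have /andP[/ltW t0 /ltW t1] := t01.
have := hm; case=> [[m0 _]|[m0 g]].
  have [c0 c'0] : 0 <= c /\ 0 <= c'.
    by split; [case: h => [[->]|[/ltW]]|case: h' => [[->]|[/ltW]]].
  move: (m0) => /eqP; rewrite paddr_eq0 ?mulr_ge0 ?subr_ge0// !mulf_eq0 subr_eq0.
  have /andP[t_gt0 t_lt1] := t01.
  rewrite (gt_eqF t_gt0) (gt_eqF t_lt1)/= => /andP[/eqP c00 /eqP c'00].
  by rewrite m0 c00 c'00 /perspective !mul0r !mulr0 addr0.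
rewrite -(tilt_eq_perspective hm m0) tilt_affine.
by rewrite lerD// ler_wpM2l ?subr_ge0// tilt_le_perspective// gap_gt0.
Qed.

Lemma perspective_strict_convex {t c a b a' b'} : 0 < t < 1 -> 0 < c ->
  phys_cone c a b -> phys_cone c a' b' -> ~ (a = a' /\ b = b') ->
  perspective (t * c + (1 - t) * c) (t * a + (1 - t) * a') (t * b + (1 - t) * b')
  < t * perspective c a b + (1 - t) * perspective c a' b'.
Proof.
move=> t01 c0 h h' n; have hm := phys_cone_convex t01 h h'.
have /andP[t0 t1] := t01; have t1' : 0 < 1 - t by lra.
have cE : t * c + (1 - t) * c = c by ring.
have m0 : 0 < t * c + (1 - t) * c by rewrite cE.
have [[mm _]|[_ g]] := hm; first by rewrite mm ltxx in m0.
have w0 := gap_gt0 m0 g; rewrite cE in w0.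
rewrite -(tilt_eq_perspective hm m0) tilt_affine cE.
rewrite ltr_leD// ?ltr_pM2l ?ler_pM2l//; last first.
  exact: tilt_le_perspective.
apply: tilt_lt_perspective => //.
(* Equality at [(a, b)] would make it coincide with the intermediate point, hence with
   [(a', b')]. *)
rewrite ![c * (_ / c)]mulrC !divfK ?gt_eqF// => -[ea eb].
have d x y : x = t * x + (1 - t) * y -> x = y.
  move=> e; have /eqP : (1 - t) * (x - y) = 0.
    rewrite (_ : (1 - t) * (x - y) = x - (t * x + (1 - t) * y)); last by ring.
    by rewrite -e subrr.
  by rewrite mulf_eq0 (gt_eqF t1') subr_eq0 => /eqP.
by apply: n; split; apply: d.
Qed.

End TangentBounds.

(** * [Xi] in the coordinates [c], [Q 0 0], [Q 0 1] *)

Section Energy.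
Context {R : realType} {M nu : R}.
Hypotheses (M0 : 0 < M) (nu0 : 0 < nu).
Implicit Types (u w c a b p r t : R) (Q : 'M[R]_2).

Definition energy c a b :=
  xlnx c + M * xlnx (1 - c / M) + nu * perspective c a b.

Lemma energy_strict_convex {t c a b c' a' b'} : 0 < t < 1 ->
  c <= M -> c' <= M -> phys_cone c a b -> phys_cone c' a' b' ->
  ~ (c = c' /\ a = a' /\ b = b') ->
  energy (t * c + (1 - t) * c') (t * a + (1 - t) * a') (t * b + (1 - t) * b')
  < t * energy c a b + (1 - t) * energy c' a' b'.
Proof.
move=> t01 cM c'M h h' n.
have [c0 c'0] : 0 <= c /\ 0 <= c'.
  by split; [case: h => [[->]|[/ltW]]|case: h' => [[->]|[/ltW]]].
have gap0 x : x <= M -> 0 <= 1 - x / M.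
  by move=> xM; rewrite subr_ge0 ler_pdivrMr// mul1r.
have mE : 1 - (t * c + (1 - t) * c') / M
    = t * (1 - c / M) + (1 - t) * (1 - c' / M) by ring.
rewrite /energy mE.
have hM := xlnx_convex (gap0 _ cM) (gap0 _ c'M) t01.
rewrite -(ler_pM2l M0) in hM.
have [ecc|ncc] := eqVneq c c'; last first.
  have hc := xlnx_strict_convex c0 c'0 t01 ncc.
  have := perspective_convex t01 h h'; rewrite -(ler_pM2l nu0); lra.
subst c'; have hc := xlnx_convex c0 c0 t01.
(* With equal [c], the value [c = 0] would put both points at the apex. *)
have c_gt0 : 0 < c.
  case: h => [[c00 [a0 b0]]|[]//]; case: h' => [[_ [a'0 b'0]]|[]//].
  by case: n; rewrite a0 b0 a'0 b'0.
have nab : ~ (a = a' /\ b = b') by move=> [ea eb]; apply: n.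
have := perspective_strict_convex t01 c_gt0 h h' nab.
rewrite -(ltr_pM2l nu0); lra.
Qed.

(** The three tangents have independent contact points, since no single point serves all of them
    when [c = 0], [c = M] or [Q] lies on the boundary. *)
Definition energy_minorant w1 w2 w p r c a b :=
  c * (1 + ln w1) - w1 + M * ((1 - c / M) * (1 + ln w2) - w2)
  + nu * tilt w p r c a b.

Lemma QphysE {c Q} : sym_traceless Q ->
  Qphys M (c, Q) <-> c <= M /\ phys_cone c (Q 0 0) (Q 0 1).
Proof.
move=> st; split=> -[cM h]; split=> //; case: h => [[c0]|].
- by move=> ->; left; rewrite !mxE.
- move=> [c0 _ /spectrum_in_oo]; rewrite divr_gt0// => /(_ st isT).
  by rewrite expr_div_n => h; right; split=> //; lra.
- move=> [q0 q1]; left; split=> //; apply: sym_traceless_eq0 => //.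
  by rewrite q0 q1 expr0n /= addr0.
- move=> [c0 h]; right; split=> //; apply/spectrum_in_oo; rewrite ?divr_gt0//.
  by rewrite expr_div_n; lra.
Qed.

Lemma Qphys_sym_traceless {c Q} : Qphys M (c, Q) -> sym_traceless Q.
Proof.
move=> [_ [[_ ->]|[]//]].
by split; rewrite ?trmx0 ?mxtrace0.
Qed.

(** [det (S + I/2)] is one quarter of [1 - 4 (a^2 + b^2)], and [ln (1/4)] cancels against
    [ln (det (I/2))]. *)
Lemma q_sym_traceless {S : 'M[R]_2} : sym_traceless S ->
  q S = if 4 * (S 0 0 ^+ 2 + S 0 1 ^+ 2) < 1
        then (- ln (1 - 4 * (S 0 0 ^+ 2 + S 0 1 ^+ 2)))%:E else +oo%E.
Proof.
move=> st; have [Ss St] := st.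
have S10 : S 1 0 = S 0 1 by rewrite -{1}Ss mxE.
have S11 : S 1 1 = - S 0 0.
  by apply/eqP; rewrite -addr_eq0 addrC -mxtrace2 St.
have spE : (spectrum_in S `](- 2^-1), 2^-1[) <-> 4 * (S 0 0 ^+ 2 + S 0 1 ^+ 2) < 1.
  have half0 : 0 < 2^-1 :> R by rewrite invr_gt0.
  rewrite (spectrum_in_oo st half0) exprVn; split=> h; lra.
rewrite /q (asbool_equiv_eq spE) asboolb; case: ifPn => // h.
rewrite !det2 !mxE S10 S11 /= mulr1n !mulr0n !(addr0, mulr0, subr0).
congr (_%:E).
have -> : (S 0 0 + 2^-1) * (- S 0 0 + 2^-1) - S 0 1 * S 0 1
    = 2^-1 * 2^-1 * (1 - 4 * (S 0 0 ^+ 2 + S 0 1 ^+ 2)) by field.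
rewrite lnM ?posrE ?mulr_gt0 ?invr_gt0 ?subr_gt0//; ring.
Qed.

Lemma Xi_sym_traceless {c Q} : 0 < c -> sym_traceless Q ->
  Xi M nu (c, Q) = if 4 * (Q 0 0 ^+ 2 + Q 0 1 ^+ 2) < c ^+ 2
                   then (energy c (Q 0 0) (Q 0 1))%:E else +oo%E.
Proof.
move=> c0 st; rewrite /Xi gt_eqF//= q_sym_traceless; last first.
  by case: st => Qs Qt; split; rewrite ?linearZ /= ?Qs ?Qt ?mulr0.
have -> : 4 * ((c^-1 *: Q) 0 0 ^+ 2 + (c^-1 *: Q) 0 1 ^+ 2)
    = 4 * (Q 0 0 ^+ 2 + Q 0 1 ^+ 2) / c ^+ 2.
  by rewrite !mxE; field; rewrite gt_eqF.
rewrite ltr_pdivrMr ?exprn_gt0// mul1r; case: ifPn => h.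
  rewrite -EFinM -EFinD; congr (_%:E).
  rewrite /energy /perspective /xlnx; congr (_ + _ + _); last by ring.
  by rewrite mulrA mulrBr mulr1 mulrCA divff ?mulr1 ?gt_eqF.
by rewrite gt0_muley ?lte_fin ?mulr_gt0// addey.
Qed.

Lemma Xi_Qphys {c Q} : Qphys M (c, Q) ->
  Xi M nu (c, Q) = (energy c (Q 0 0) (Q 0 1))%:E.
Proof.
move=> phys; have st := Qphys_sym_traceless phys.
have [_ [[c0 [q0 q1]]|[c0 h]]] := (QphysE st).1 phys.
  have -> : Q = 0 by apply: sym_traceless_eq0; rewrite // q0 q1 expr0n /= addr0.
  rewrite c0 /Xi !eqxx /= /energy /xlnx /perspective !mul0r subr0 ln1.
  by rewrite !mulr0 !addr0.
by rewrite Xi_sym_traceless// h.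
Qed.

(** * Strict convexity on the physical domain *)

Lemma strictly_convex_Xi : strictly_convex_on (Qphys M) (Xi M nu).
Proof.
have st_conv t (Q Q' : 'M[R]_2) : sym_traceless Q -> sym_traceless Q' ->
    sym_traceless (t *: Q + (1 - t) *: Q').
  move=> [Qs Qt] [Q's Q't]; split; first by rewrite linearD !linearZ /= Qs Q's.
  by rewrite mxtraceD !mxtraceZ Qt Q't !mulr0 addr0.
have phys_conv t c c' Q Q' : 0 < t < 1 -> Qphys M (c, Q) -> Qphys M (c', Q') ->
    Qphys M (t * c + (1 - t) * c', t *: Q + (1 - t) *: Q').
  move=> t01 x y; have stx := Qphys_sym_traceless x.
  have sty := Qphys_sym_traceless y.
  have [cM hx] := (QphysE stx).1 x; have [c'M hy] := (QphysE sty).1 y.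
  have /andP[t0 t1] := t01.
  apply/QphysE; first exact: st_conv.
  split; last by rewrite !mxE; exact: phys_cone_convex.
  have -> : M = t * M + (1 - t) * M by ring.
  by rewrite lerD// ler_wpM2l// ?subr_ge0// ltW.
split.
  apply/convex_setW => -[c Q] [c' Q'] /set_mem x /set_mem y k k0 k1.
  apply/mem_set; have := phys_conv k%:num c c' Q Q'; rewrite k0 k1; exact.
move=> [c Q] [c' Q'] t x y xy t01.
have m := phys_conv _ _ _ _ _ t01 x y.
rewrite (_ : t *: (c, Q) + _ = (t * c + (1 - t) * c', t *: Q + (1 - t) *: Q'))//.
rewrite !Xi_Qphys// -!EFinM -EFinD lte_fin !mxE.
have stx := Qphys_sym_traceless x; have sty := Qphys_sym_traceless y.
have [cM hx] := (QphysE stx).1 x; have [c'M hy] := (QphysE sty).1 y.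
apply: energy_strict_convex => // -[ec [e0 e1]]; apply: xy.
(* [Q - Q'] is symmetric and traceless with zero first row, hence zero. *)
congr (_, _) => //; apply/eqP; rewrite -subr_eq0; apply/eqP.
apply: sym_traceless_eq0; last by rewrite !mxE e0 e1 !subrr expr0n /= addr0.
case: stx sty => Qs Qt [Q's Q't].
by split; [rewrite linearB /= Qs Q's|rewrite linearB /= Qt Q't subr0].
Qed.

(** * Affine minorants, lower semicontinuity and the lower bound *)

Lemma Qphysbar_eq0 {Q} : Qphysbar M (0, Q) -> Q = 0.
Proof.
move=> [_ st /spectrum_in_cc]; rewrite mul0r lexx => /(_ st isT).
by rewrite expr0n; exact: sym_traceless_eq0.
Qed.

Lemma energy_minorant_le_Xi {w1 w2 w p r c Q} : 0 < w1 -> 0 < w2 -> 0 < w ->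
  Qphysbar M (c, Q) ->
  ((energy_minorant w1 w2 w p r c (Q 0 0) (Q 0 1))%:E <= Xi M nu (c, Q))%E.
Proof.
move=> w1_gt0 w2_gt0 w_gt0 x; have [/andP[c0 cM] st _] := x.
suff phys : Qphys M (c, Q) ->
    ((energy_minorant w1 w2 w p r c (Q 0 0) (Q 0 1))%:E <= Xi M nu (c, Q))%E.
  move: c0 x phys; rewrite le_eqVlt => /predU1P[<-|c0].
    by move=> /Qphysbar_eq0 -> ; apply; split; [exact: ltW|left].
  move=> _; have [h|h] := boolP (4 * (Q 0 0 ^+ 2 + Q 0 1 ^+ 2) < c ^+ 2).
    by apply; apply/QphysE => //; split=> //; right.
  by rewrite Xi_sym_traceless// (negPf h) leey.
move=> phys; rewrite Xi_Qphys// lee_fin; have [_ h] := (QphysE st).1 phys.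
have gap0 : 0 <= 1 - c / M by rewrite subr_ge0 ler_pdivrMr// mul1r.
rewrite /energy_minorant /energy !lerD ?ler_pM2l//.
- exact: xlnx_tangent.
- exact: xlnx_tangent.
- exact: tilt_le_perspective.
Qed.

Lemma energy_minorant_approx {a c Q} : Qphysbar M (c, Q) ->
  (a%:E < Xi M nu (c, Q))%E ->
  exists w1 w2 w p r, [/\ 0 < w1, 0 < w2, 0 < w
    & a < energy_minorant w1 w2 w p r c (Q 0 0) (Q 0 1)].
Proof.
move=> x; have [/andP[+ cM] st _] := x; rewrite le_eqVlt => /predU1P[c0|c0].
  subst c; rewrite (Qphysbar_eq0 x) /Xi !eqxx /= lte_fin => a0.
  (* At the apex only the tangent of [c ln c] contributes, with value [- w1 = a / 2 > a]. *)
  exists (- a / 2), 1, 1, 0, 0; split=> //; first by lra.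
  by rewrite /energy_minorant /tilt !mxE ln1 !(mul0r, mulr0); lra.
have gap0 : 0 <= 1 - c / M by rewrite subr_ge0 ler_pdivrMr// mul1r.
rewrite Xi_sym_traceless//; case: ifPn => [h|].
  rewrite lte_fin /energy => a_lt.
  have : (a - xlnx c - nu * perspective c (Q 0 0) (Q 0 1)) / M < xlnx (1 - c / M).
    by rewrite ltr_pdivrMr// [_ * M]mulrC; lra.
  move=> /(xlnx_tangent_approx gap0)[w2 w2_gt0].
  rewrite ltr_pdivrMr// [_ * M]mulrC => a_lt'.
  have cone : phys_cone c (Q 0 0) (Q 0 1) by right.
  (* Two of the tangents are exact here; the one in [1 - c / M] is only approximate because [c = M]
     is possible. *)
  exists c, w2, (1 - 4 * (Q 0 0 ^+ 2 + Q 0 1 ^+ 2) / c ^+ 2), (Q 0 0 / c), (Q 0 1 / c).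
  split=> //; first exact: gap_gt0.
  rewrite /energy_minorant tilt_eq_perspective//.
  have -> : c * (1 + ln c) - c = xlnx c by rewrite /xlnx; ring.
  lra.
rewrite -leNgt => h _.
(* Where [Xi] is [+oo], [A] is what the [tilt] term has to exceed. With [(p, r) = (a, b) / c] in
   matrix coordinates, that term is at least [nu c (1 - ln w)], because [1 - 4 (a^2 + b^2) / c^2] is
   nonpositive; the chosen [w] turns this into [nu c + A]. *)
set A := a - (c * (1 + ln 1) - 1 + M * ((1 - c / M) * (1 + ln 1) - 1)).
pose w := expR (- (A / (nu * c))).
have w0 : 0 < w by exact: expR_gt0.
exists 1, 1, w, (Q 0 0 / c), (Q 0 1 / c); split=> //.
rewrite /energy_minorant -ltrBlDl -/A.
have := tilt_le_tangent (Q 0 0 / c) (Q 0 1 / c) (Q 0 0) (Q 0 1) c0 w0.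
rewrite ![c * (_ / c)]mulrC !(divfK (lt0r_neq0 c0)) !eqxx => -[_ /eqP ->].
rewrite -subr_gt0 expRK opprK.
have -> : nu * (c * (1 + A / (nu * c) - (1 - 4 * (Q 0 0 ^+ 2 + Q 0 1 ^+ 2) / c ^+ 2) / w)) - A
  = nu * c * (1 + (4 * (Q 0 0 ^+ 2 + Q 0 1 ^+ 2) / c ^+ 2 - 1) / w).
  by field; rewrite !gt_eqF.
rewrite !mulr_gt0// ltr_pwDl// divr_ge0 ?(ltW w0)// subr_ge0.
by rewrite ler_pdivlMr ?exprn_gt0// mul1r.
Qed.

Lemma continuous_energy_minorant w1 w2 w p r :
  continuous (fun x : R^o * 'M[R]_2 =>
    energy_minorant w1 w2 w p r x.1 (x.2 0 0) (x.2 0 1)).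
Proof.
(* The coefficient of [c] once the minorant is written as an affine function; [M / M] stays
   unreduced so that [ring] can close the identity. *)
pose k := 1 + ln w1 - M / M * (1 + ln w2)
  + nu * (1 - ln w - (1 + 4 * (p ^+ 2 + r ^+ 2)) / w).
have -> : (fun x : R^o * 'M[R]_2 =>
    energy_minorant w1 w2 w p r x.1 (x.2 0 0) (x.2 0 1))
  = (fun x => - w1 + M * (1 + ln w2 - w2) + k * (x.1 : R)
       + nu * (8 * p / w) * x.2 0 0 + nu * (8 * r / w) * x.2 0 1).
  by apply/funext => x; rewrite /energy_minorant /tilt /k; ring.
have cent i j : continuous (fun x : R^o * 'M[R]_2 => x.2 i j : R).
  move=> x; apply: (@continuous_comp _ _ _ snd (fun A : 'M[R]_2 => A i j)).
    exact: cvg_snd.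
  exact: coord_continuous.
move=> x; apply: cvgD; [apply: cvgD; [apply: cvgD|]|].
- exact: cvg_cst.
- by apply: cvgM; [exact: cvg_cst|exact: cvg_fst].
- by apply: cvgM; [exact: cvg_cst|exact: cent].
- by apply: cvgM; [exact: cvg_cst|exact: cent].
Qed.

Lemma lsc_Xi : lsc_on (Qphysbar M) (Xi M nu).
Proof.
move=> x a ax.
case: (nbhs_subspaceP (Qphysbar M) x) => xD; last first.
  (* In the subspace topology, points outside the subspace are isolated. *)
  by exists [set x] => // y ->.
case: x => c Q in ax xD *.
have [w1 [w2 [w [p [r [w1_gt0 w2_gt0 w0 lt]]]]]] := energy_minorant_approx xD ax.
exists (Qphysbar M `&` [set y : R^o * 'M[R]_2 |
    a < energy_minorant w1 w2 w p r y.1 (y.2 0 0) (y.2 0 1)]).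
  have /(_ (c, Q)) := @continuous_energy_minorant w1 w2 w p r.
  move=> /cvgr_gt /(_ _ lt) near_lt.
  by rewrite /within /=; apply: filterS near_lt => y.
move=> [d P] [yD /= alt].
have := energy_minorant_le_Xi (p := p) (r := r) w1_gt0 w2_gt0 w0 yD.
by apply: lt_le_trans; rewrite lte_fin.
Qed.

(** With contact points [1] and [p = r = 0], the [tilt] term vanishes, the two terms in [c] cancel,
    and the minorant is the constant [- 1]. *)
Lemma Xi_ge x : Qphysbar M x -> ((- 1)%:E <= Xi M nu x)%E.
Proof.
case: x => c Q xD.
apply: le_trans (energy_minorant_le_Xi (p := 0) (r := 0) ltr01 ltr01 ltr01 xD).
rewrite lee_fin /energy_minorant /tilt ln1.
have -> : M * ((1 - c / M) * (1 + 0) - 1) = - c by field; rewrite gt_eqF.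
lra.
Qed.

End Energy.

(** * Invariance under orthogonal conjugation *)

Section Rotation.
Context {R : realType} {T : 'M[R]_2}.
Hypothesis orthT : T *m T^T = 1%:M.

(** Eigenvectors are rows here, so [v] for [Q] is carried to [v *m U^T], nonzero because [U^T] is
    invertible. *)
Lemma eigenvalue_orthogonal (U Q : 'M[R]_2) l : U^T *m U = 1%:M ->
  eigenvalue Q l -> eigenvalue (U *m Q *m U^T) l.
Proof.
move=> UU /eigenvalueP[v vQ v0]; apply/eigenvalueP; exists (v *m U^T).
  by rewrite -!mulmxA (mulmxA U^T) UU mul1mx mulmxA vQ scalemxAl.
by apply: contra_neq v0 => vU; rewrite -[v]mulmx1 -UU mulmxA vU mul0mx.
Qed.

Lemma orth_conjK (Q : 'M[R]_2) : T^T *m (T *m Q *m T^T) *m T = Q.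
Proof.
by have TT := mulmx1C orthT; rewrite !mulmxA TT mul1mx -mulmxA TT mulmx1.
Qed.

Lemma q_orthogonal (Q : 'M[R]_2) : q (T *m Q *m T^T) = q Q.
Proof.
have TT := mulmx1C orthT; rewrite /q.
have -> : `[< spectrum_in (T *m Q *m T^T) `](- 2^-1), 2^-1[ >]
    = `[< spectrum_in Q `](- 2^-1), 2^-1[ >].
  apply: asbool_equiv_eq; split=> sp l El; apply: sp.
    exact: eigenvalue_orthogonal.
  (* The converse is the same lemma for [U = T^T], with [Q] written as the conjugate of
     [T *m Q *m T^T]. *)
  rewrite -[Q]orth_conjK -[X in _ *m X]trmxK.
  by apply: eigenvalue_orthogonal El; rewrite trmxK.
have -> : T *m Q *m T^T + (2^-1)%:M = T *m (Q + (2^-1)%:M) *m T^T.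
  by rewrite mulmxDr mulmxDl mul_mx_scalar -scalemxAl orthT scalemx1.
by rewrite !det_mulmx mulrAC -det_mulmx orthT det1 mul1r.
Qed.

Lemma Xi_orthogonal (M nu c : R) (Q : 'M[R]_2) :
  Xi M nu (c, T *m Q *m T^T) = Xi M nu (c, Q).
Proof.
rewrite /Xi scalemxAl scalemxAr q_orthogonal.
suff -> : (T *m Q *m T^T == 0) = (Q == 0) by [].
apply/eqP/eqP => [Q0|->]; last by rewrite mulmx0 mul0mx.
by rewrite -[Q]orth_conjK Q0 mulmx0 mul0mx.
Qed.

End Rotation.

Theorem theorem2p4 (R : realType) (M nu : R) (hM : 0 < M) (hnu : 0 < nu) :
  (forall (T : 'M[R]_2), T *m T^T = 1%:M ->
     forall (c : R) (Q : 'M[R]_2),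
       Xi M nu (c, T *m Q *m T^T) = Xi M nu (c, Q)) /\
  (strictly_convex_on (Qphys M) (Xi M nu) /\
   exists m : R, forall x, Qphysbar M x -> (m%:E <= Xi M nu x)%E) /\
  lsc_on (Qphysbar M) (Xi M nu).
Proof.
split=> [T orthT c Q|]; first exact: Xi_orthogonal.
split; last exact: lsc_Xi.
by split; [exact: strictly_convex_Xi|exists (- 1) => x; exact: Xi_ge].
Qed.
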